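(* Let $p:\mathbb{N}\to[0,1]$ be a natural function. Then there is an avgFPT-algorithm for $k$-Clique on graphs $G\in\mathcal{G}(n,p)$; that is, there is a deterministic algorithm $\mathcal{A}$ which, on every input graph $G$ and integer $k$, correctly decides whether $G$ contains a clique of size $k$, and for which there exist a constant $c$ and a function $f:\mathbb{N}\to\mathbb{N}$ such that for all $k\in\mathbb{N}$, $$\sum_{n\in\mathbb{N}} \mathsf{E}\left[\frac{t_{\mathcal{A}}(\mathcal{G}(n,p),k)}{n^c}\right] < f(k),$$ where $t_{\mathcal{A}}(\mathcal{G}(n,p),k)$ denotes the running time of $\mathcal{A}$ on input $(G,k)$ with $G$ drawn from $\mathcal{G}(n,p)$.
   Context: $k$-Clique is the problem: given a graph $G$ and a positive integer $k$ (the parameter), decide whether $G$ contains a complete subgraph on $k$ vertices. $\mathcal{G}(n,p)$ denotes the Erdős–Rényi random graph on vertex set $\{1,\dots,n\}$ in which each pair of vertices is joined by an edge independently with probability $p=p(n)$. A function $p:\mathbb{N}\to[0,1]$ is called natural if either $p(n)=0$ for all $n\in\mathbb{N}$, or $p(n)=n^{-g(n)}$ for a non-negative function $g$ such that the limit $\lim_{n\to\infty} g(n)$ exists. *)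

(* Defs.v *)
From mathcomp Require Import all_boot all_order all_algebra.
From mathcomp Require Import all_classical all_reals all_analysis.

Set Implicit Arguments.
Unset Strict Implicit.
Unset Printing Implicit Defensive.

Import Order.TTheory GRing.Theory Num.Theory.
Import numFieldNormedType.Exports.

Local Open Scope ring_scope.

(* Vertices are numbered 0, ..., n-1. A simple graph is a set of unordered
   pairs of distinct vertices. *)
Definition edge (n : nat) : Type := {e : {set 'I_n} | #|e| == 2%N}.

Definition graph (n : nat) : Type := {set edge n}.

Definition adj (n : nat) (G : graph n) (i j : 'I_n) : bool :=
  [exists e : edge n, (e \in G) && (val e == [set i; j]%SET)].

Definition clique (n : nat) (G : graph n) (S : {set 'I_n}) : bool :=
  [forall i in S, forall j in S, (i != j) ==> adj G i j].

Definition has_clique (n : nat) (G : graph n) (k : nat) : bool :=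
  [exists S : {set 'I_n}, (#|S| == k) && clique G S].

(* The probability mass function of the Erdos-Renyi distribution, and the
   expectation of a random variable under it. *)
Definition gnp (R : realType) (n : nat) (p : R) (G : graph n) : R :=
  \prod_(e : edge n) (if e \in G then p else 1 - p).

Definition gnp_expectation (R : realType) (n : nat) (p : R)
    (X : graph n -> \bar R) : \bar R :=
  (\sum_(G : graph n) (gnp p G)%:E * X G)%E.

(* The value at 0 is left unconstrained: n ranges over the positive integers,
   and 0 `^ (- x) is a junk value. *)
Definition natural_function (R : realType) (p : nat -> R) : Prop :=
  (forall n : nat, (0 < n)%N -> p n = 0) \/
  exists g : nat -> R,
    [/\ forall n : nat, 0 <= g n,
        cvgn g
      & forall n : nat, (0 < n)%N -> p n = n%:R `^ (- g n)].

(* Random access machines with unit cost (Cook and Reckhow). There is no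
   multiplication, so a machine can only produce numbers of length linear in
   its running time, up to the length of the input numbers, and unit cost is
   polynomially related to Turing machine time. *)
Inductive instr : Type :=
  | Const of nat & nat          (* X_i := a *)
  | Add of nat & nat & nat      (* X_i := X_j + X_l *)
  | Sub of nat & nat & nat      (* X_i := X_j - X_l, truncated at 0 *)
  | Fetch of nat & nat          (* X_i := X_(X_j) *)
  | Store of nat & nat          (* X_(X_i) := X_j *)
  | Read of nat & nat           (* X_i := item X_j of the input, 0 if none *)
  | JumpPos of nat & nat.       (* if X_i > 0 then go to instruction m *)

Definition program := seq instr.

Record config := Config { pc : nat; regs : nat -> nat }.

Definition exec (input : seq nat) (i : instr) (s : config) : config :=
  let X := regs s in
  let set_next r v := Config (pc s).+1 [eta X with r |-> v] in
  match i with
  | Const i a => set_next i a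
  | Add i j l => set_next i (X j + X l)%N
  | Sub i j l => set_next i (X j - X l)%N
  | Fetch i j => set_next i (X (X j))
  | Store i j => set_next (X i) (X j)
  | Read i j => set_next i (nth 0%N input (X j))
  | JumpPos i m => if (0 < X i)%N then Config m X else Config (pc s).+1 X
  end.

(* The machine halts when the program counter leaves the program. *)
Definition step (A : program) (input : seq nat) (s : config) : config :=
  if onth A (pc s) is Some i then exec input i s else s.

Definition run (A : program) (input : seq nat) (t : nat) : config :=
  iter t (step A input) (Config 0 (fun=> 0%N)).

Definition halted (A : program) (s : config) : bool := (size A <= pc s)%N.

(* The number of executed instructions; +oo if the machine does not halt. *)
Definition running_time (R : realType) (A : program) (input : seq nat) :
    \bar R :=
  ereal_inf [set t%:R%:E | t in [set t : nat | halted A (run A input t)]].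

(* The machine halts, and answers yes iff X_0 is then positive. *)
Definition outputs (A : program) (input : seq nat) (b : bool) : Prop :=
  exists t : nat, halted A (run A input t) /\
    (0 < regs (run A input t) 0)%N = b.

(* The order of the graph, the parameter, and the adjacency matrix by rows. *)
Definition encode (n : nat) (G : graph n) (k : nat) : seq nat :=
  [:: n, k & [seq nat_of_bool (adj G i j) | i <- enum 'I_n, j <- enum 'I_n]].

Definition decides_clique (A : program) : Prop :=
  forall (n : nat) (G : graph n) (k : nat),
    outputs A (encode G k) (has_clique G k).

(* The sum starts at 1 because of the division by n ^ c. *)
Definition avgFPT_time (R : realType) (p : nat -> R) (A : program) : Prop :=
  exists (c : nat) (f : nat -> nat), forall k : nat,
    (\sum_(1 <= n <oo)
       gnp_expectation (p n)
         (fun G : graph n => running_time R A (encode G k) / (n%:R ^+ c)%:E)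
     < (f k)%:R%:E)%E.

(* Main.v *)
(* The cliques among the vertices 0, ..., m-1 are listed for growing m: those
   whose largest vertex is m arise from the listed cliques all of whose vertices
   are adjacent to m. The machine accepts as soon as a k-clique appears, so the
   first M vertices cost it a constant times M times the number of their cliques
   of size less than k.
   If p = n^-g with lim g > 0 (or p = 0), then the expected number of all
   cliques, the sum of C(n, j) p^C(j, 2), is polynomial in n with a degree
   independent of k. If lim g = 0, then p^K >= 1/n for every fixed K and large n, and disjoint
   blocks of k vertices show that a k-clique exists among roughly the first
   n^(1/(k+1)) vertices, except with a probability that compensates for the
   n^(k+1) steps of the exhaustive search. *)
Require Import Defs.
From mathcomp Require Import all_boot all_order all_algebra.
From mathcomp Require Import all_classical all_reals all_analysis.
From mathcomp Require Import zify ring lra.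
Import Order.TTheory GRing.Theory Num.Theory.
Import numFieldNormedType.Exports.

Set Implicit Arguments.
Unset Strict Implicit.
Unset Printing Implicit Defensive.

(** * Lists of cliques *)

Lemma gtn_trans : transitive gtn.
Proof. by move=> y x z yx zy; apply: ltn_trans zy yx. Qed.

(** Each subset of {0, ..., m-1} is represented by its strictly decreasing list, so the head is the
    largest vertex. *)
Fixpoint declists (m : nat) : seq (seq nat) :=
  if m is m'.+1 then declists m' ++ [seq m' :: s | s <- declists m']
  else [:: [::]].

Definition extend (r : rel nat) (m : nat) (l : seq (seq nat)) :=
  [seq m :: s | s <- l & all (r m) s].

(** The order is that in which the machine creates its nodes: the old list stays a prefix, so a
    clique keeps its index. *)
Fixpoint cliques (r : rel nat) (m : nat) : seq (seq nat) :=
  if m is m'.+1 then cliques r m' ++ extend r m' (cliques r m')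
  else [:: [::]].

Lemma cliques_filter r m :
  cliques r m = [seq s <- declists m | pairwise r s].
Proof.
elim: m => //= m IH; rewrite filter_cat IH; congr cat.
rewrite filter_map /extend; congr map.
by rewrite -filter_predI; apply: eq_filter => s /=.
Qed.

Lemma size_cliques_gt0 r m : 0 < size (cliques r m).
Proof. by elim: m => //= m IH; rewrite size_cat addn_gt0 IH. Qed.

Lemma mem_declists m s :
  (s \in declists m) = sorted gtn s && all (fun v => v < m) s.
Proof.
elim: m s => [|m IH] s /=.
  by rewrite inE; case: s => //= a s; rewrite andbF.
rewrite mem_cat IH; apply/idP/idP.
  case/orP => [/andP[-> /=]|].
    by apply: sub_all => v /ltnW; rewrite ltnS.
  case/mapP => s'; rewrite IH => /andP[ss sm] -> /=.
  rewrite ltnSn /= path_sortedE; last exact: gtn_trans.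
  rewrite ss andbT; apply/andP; split; first exact: sm.
  by apply: sub_all sm => v /ltnW; rewrite ltnS.
case/andP; case: s => [|a s] //= ss /andP[am sm].
rewrite ss /=.
have [am'|ma] := ltnP a m; apply/orP; [left|right].
  apply/allP => v vs; apply: ltn_trans am'.
  move: ss; rewrite path_sortedE; last exact: gtn_trans.
  by case/andP => /allP /(_ _ vs).
have -> : a = m by apply/eqP; rewrite eqn_leq ma -ltnS am.
apply/map_f; rewrite IH.
move: ss; rewrite path_sortedE; last exact: gtn_trans.
have -> : a = m by apply/eqP; rewrite eqn_leq ma -ltnS am.
by case/andP => h ->; exact: h.
Qed.

Lemma count_size_declists j m :
  count (fun s => size s == j) (declists m) = 'C(m, j).
Proof.
elim: m j => [|m IH] j /=; first by case: j.
rewrite count_cat count_map IH.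
case: j => [|j] /=; first by rewrite bin0 (@eq_count _ _ pred0) ?count_pred0 ?bin0.
by rewrite binS; congr addn; rewrite -IH; apply: eq_count.
Qed.

(** Holds for every graph and is polynomial for fixed [k]; in the dense case it bounds both the
    search in the blocks and the exhaustive search. *)
Lemma count_short_declists k m :
  count (fun s => size s < k) (declists m) <= m.+1 ^ k.
Proof.
elim: m k => [|m IH] k /=; first by rewrite exp1n; case: k.
rewrite count_cat count_map.
case: k => [|k]; first by rewrite !(@eq_count _ _ pred0) ?count_pred0.
have H := leq_add (IH k.+1) (IH k).
apply: leq_trans H _; rewrite !expnS -mulSnr; apply: leq_mul => //.
by case: k => // k; rewrite leq_exp2r.
Qed.

Lemma count_short_cliques r k m :
  count (fun s => size s < k) (cliques r m) <= m.+1 ^ k.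
Proof.
apply: leq_trans (count_short_declists k m).
by rewrite cliques_filter count_filter; apply: sub_count => s /andP[].
Qed.

Lemma cliques_mono r k m :
  count (fun s => size s < k) (cliques r m) <=
  count (fun s => size s < k) (cliques r m.+1).
Proof. by rewrite /= count_cat leq_addr. Qed.

(** * The machine *)

(* Registers 0-10: the answer, 1, n, k, the current vertex m, the offset of
   row m, the current node, the end of the nodes to be extended, the first free
   address, two temporaries. The j-th clique is stored from address 11 + 3j on:
   its size plus 1 if all its vertices are adjacent to m and 0 otherwise (once
   it has been processed for m), the row offset of its largest vertex, and the
   address of the clique without this vertex. *)
Definition clique_program : program :=
  [:: Const 1 1; Read 2 0; Read 3 1; JumpPos 3 5; JumpPos 1 43;
      Const 5 2; Const 8 14;
      (* 7: next vertex *)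
      Defs.Sub 10 2 4; JumpPos 10 10; JumpPos 1 44;
      Const 6 11; Add 7 8 0; Const 9 1;
      (* 13: the current clique extends by m *)
      Store 6 9; Defs.Sub 10 3 9; JumpPos 10 17; JumpPos 1 43;
      Add 8 8 1; Store 8 5; Add 8 8 1; Store 8 6; Add 8 8 1;
      (* 22: next clique *)
      Const 10 3; Add 6 6 10; Defs.Sub 10 7 6; JumpPos 10 29;
      Add 4 4 1; Add 5 5 2; JumpPos 1 7;
      (* 29: does the current clique extend by m? *)
      Add 10 6 1; Fetch 9 10; Add 9 9 4; Read 9 9; JumpPos 9 36;
      Store 6 0; JumpPos 1 22;
      Add 10 10 1; Fetch 9 10; Fetch 9 9; JumpPos 9 41; JumpPos 1 34;
      Add 9 9 1; JumpPos 1 13;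
      (* 43: accept *)
      Const 0 1].

(** * Layout of the memory *)

Definition node (j : nat) : nat := 11 + 3 * j.

Definition upd (f : nat -> nat) (i v : nat) : nat -> nat :=
  fun j => if j == i then v else f j.

Definition nodes (f row par : nat -> nat) (a : nat) : nat :=
  match a %% 3 with
  | 0 => f (a %/ 3) | 1 => row (a %/ 3) | _ => par (a %/ 3)
  end.

(** [low] lists registers 0 to 10; above them the arrays [f], [row] and [par] are interleaved as the
    three fields of the nodes. Recursion on [low] lets accesses to numbered registers compute by
    [simpl]. *)
Fixpoint memory (low : seq nat) (f row par : nat -> nat) (a : nat) : nat :=
  match low, a with
  | [::], _ => nodes f row par a
  | x :: _, 0 => x
  | _ :: low', a'.+1 => memory low' f row par a'
  end.

Lemma memoryE low f row par a :
  memory low f row par a =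
  if a < size low then nth 0 low a else nodes f row par (a - size low).
Proof. by elim: low a => [|x l IH] [|a] //=; rewrite IH ltnS subSS. Qed.

Section Memory.
Variables (low : seq nat) (f row par : nat -> nat).

Lemma memory_low i v : i < size low ->
  [eta memory low f row par with i |-> v] =
  memory (set_nth 0 low i v) f row par :> (nat -> nat).
Proof.
move=> il; apply/funext => a /=; rewrite !memoryE size_set_nth nth_set_nth /=.
rewrite (maxn_idPr il); case: eqP => [->|//]; first by rewrite il.
Qed.

Hypothesis size_low : size low = 11.

Lemma memory_size j : memory low f row par (node j) = f j.
Proof.
have -> : node j = 11 + (j * 3 + 0) by rewrite /node; lia.
by rewrite memoryE size_low ltnNge leq_addr addKn /nodes modnMDl divnMDl //= addn0.
Qed.

Lemma memory_row j : memory low f row par (node j + 1) = row j.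
Proof.
have -> : node j + 1 = 11 + (j * 3 + 1) by rewrite /node; lia.
by rewrite memoryE size_low ltnNge leq_addr addKn /nodes modnMDl divnMDl //= addn0.
Qed.

Lemma memory_par j : memory low f row par (node j + 1 + 1) = par j.
Proof.
have -> : node j + 1 + 1 = 11 + (j * 3 + 2) by rewrite /node; lia.
by rewrite memoryE size_low ltnNge leq_addr addKn /nodes modnMDl divnMDl //= addn0.
Qed.

Lemma nodes_eq a v i c : c < 3 ->
  a = 11 + 3 * i + c ->
  [eta memory low f row par with a |-> v] =
  memory low (if c == 0 then upd f i v else f) (if c == 1 then upd row i v else row)
   (if c == 2 then upd par i v else par) :> (nat -> nat).
Proof.
move=> c3 ->; apply/funext => b /=; rewrite !memoryE size_low.
have [b11|b11] := ltnP b 11.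
  by rewrite ifF //; apply/negbTE; lia.
rewrite /nodes /upd.
have := divn_eq (b - 11) 3; have := ltn_pmod (b - 11) (isT : 0 < 3).
move: ((b - 11) %/ 3) ((b-11) %% 3) => q t t3 bE.
have -> : (b == 11 + 3 * i + c) = (q == i) && (t == c) by lia.
by move: c t c3 t3 {bE} => [|[|[|c]]] [|[|[|t]]] //= _ _;
  rewrite ?andbT ?andbF //; case: eqP.
Qed.

Lemma memory_upd_size i v :
  [eta memory low f row par with node i |-> v] =
  memory low (upd f i v) row par :> (nat -> nat).
Proof. by rewrite (@nodes_eq _ _ i 0) // addn0. Qed.

Lemma memory_upd_row i v :
  [eta memory low f row par with node i + 1 |-> v] =
  memory low f (upd row i v) par :> (nat -> nat).
Proof. by rewrite (@nodes_eq _ _ i 1). Qed.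

Lemma memory_upd_par i v :
  [eta memory low f row par with node i + 1 + 1 |-> v] =
  memory low f row (upd par i v) :> (nat -> nat).
Proof. by rewrite (@nodes_eq _ _ i 2) // -addnA. Qed.

End Memory.

(** * Symbolic execution with time bounds *)

Section Execution.
Variables (A : program) (inp : seq nat).

(** The time is only an upper bound, so that branches of different lengths can share one bound. *)
Definition reaches (t : nat) (Q : config -> Prop) (s : config) : Prop :=
  exists2 t' : nat, t' <= t & Q (iter t' (step A inp) s).

Lemma reaches_now t (Q : config -> Prop) s : Q s -> reaches t Q s.
Proof. by exists 0. Qed.

Lemma reaches_step t Q s :
  reaches t Q (step A inp s) -> reaches t.+1 Q s.
Proof. by case=> t' t't Qs; exists t'.+1; rewrite ?iterSr. Qed.

Lemma reaches_trans t1 t2 Q1 Q2 s :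
  reaches t1 Q1 s -> (forall s', Q1 s' -> reaches t2 Q2 s') ->
  reaches (t1 + t2) Q2 s.
Proof.
case=> u ut1 Q1s /(_ _ Q1s)[v vt2 Q2s].
by exists (v + u); rewrite ?iterD // addnC leq_add.
Qed.

Lemma reaches_weaken t1 t2 (Q1 Q2 : config -> Prop) s :
  t1 <= t2 -> (forall s', Q1 s' -> Q2 s') ->
  reaches t1 Q1 s -> reaches t2 Q2 s.
Proof. by move=> t12 Q12 [u ut /Q12]; exists u => //; apply: leq_trans t12. Qed.

Section Instructions.
Variables (t : nat) (Q : config -> Prop) (pc : nat).
Variables (low : seq nat) (f row par : nat -> nat).
Local Notation M := (memory low f row par).

Lemma exec_const i a :
  onth A pc = Some (Const i a) -> i < size low ->
  reaches t Q (Config pc.+1 (memory (set_nth 0 low i a) f row par)) ->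
  reaches t.+1 Q (Config pc M).
Proof.
by move=> ins il h; apply: reaches_step; rewrite /step ins /exec memory_low.
Qed.

Lemma exec_add i j l :
  onth A pc = Some (Add i j l) -> i < size low ->
  reaches t Q (Config pc.+1 (memory (set_nth 0 low i (M j + M l)) f row par)) ->
  reaches t.+1 Q (Config pc M).
Proof.
by move=> ins il h; apply: reaches_step; rewrite /step ins /exec memory_low.
Qed.

Lemma exec_sub i j l :
  onth A pc = Some (Defs.Sub i j l) -> i < size low ->
  reaches t Q (Config pc.+1 (memory (set_nth 0 low i (M j - M l)) f row par)) ->
  reaches t.+1 Q (Config pc M).
Proof.
by move=> ins il h; apply: reaches_step; rewrite /step ins /exec memory_low.
Qed.

Lemma exec_read i j :
  onth A pc = Some (Read i j) -> i < size low ->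
  reaches t Q
    (Config pc.+1 (memory (set_nth 0 low i (nth 0 inp (M j))) f row par)) ->
  reaches t.+1 Q (Config pc M).
Proof.
by move=> ins il h; apply: reaches_step; rewrite /step ins /exec memory_low.
Qed.

Lemma exec_fetch i j :
  onth A pc = Some (Fetch i j) -> i < size low ->
  reaches t Q (Config pc.+1 (memory (set_nth 0 low i (M (M j))) f row par)) ->
  reaches t.+1 Q (Config pc M).
Proof.
by move=> ins il h; apply: reaches_step; rewrite /step ins /exec memory_low.
Qed.

Lemma exec_jump i l :
  onth A pc = Some (JumpPos i l) -> 0 < M i ->
  reaches t Q (Config l M) -> reaches t.+1 Q (Config pc M).
Proof.
by move=> ins Mi h; apply: reaches_step; rewrite /step ins /exec /= Mi.
Qed.

Lemma exec_nojump i l :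
  onth A pc = Some (JumpPos i l) -> M i = 0 ->
  reaches t Q (Config pc.+1 M) -> reaches t.+1 Q (Config pc M).
Proof.
by move=> ins Mi h; apply: reaches_step; rewrite /step ins /exec /= Mi.
Qed.

Lemma exec_store_size i j l :
  onth A pc = Some (Store i j) -> M i = node l -> size low = 11 ->
  reaches t Q (Config pc.+1 (memory low (upd f l (M j)) row par)) ->
  reaches t.+1 Q (Config pc M).
Proof.
move=> ins Mi sl h; apply: reaches_step.
by rewrite /step ins /exec /= Mi memory_upd_size.
Qed.

Lemma exec_store_row i j l :
  onth A pc = Some (Store i j) -> M i = node l + 1 -> size low = 11 ->
  reaches t Q (Config pc.+1 (memory low f (upd row l (M j)) par)) ->
  reaches t.+1 Q (Config pc M).
Proof.
move=> ins Mi sl h; apply: reaches_step.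
by rewrite /step ins /exec /= Mi memory_upd_row.
Qed.

Lemma exec_store_par i j l :
  onth A pc = Some (Store i j) -> M i = node l + 1 + 1 -> size low = 11 ->
  reaches t Q (Config pc.+1 (memory low f row (upd par l (M j)))) ->
  reaches t.+1 Q (Config pc M).
Proof.
move=> ins Mi sl h; apply: reaches_step.
by rewrite /step ins /exec /= Mi memory_upd_par.
Qed.

End Instructions.
End Execution.

Lemma nodeE j : node j = 11 + 3 * j. Proof. by []. Qed.
Opaque node.
Arguments memory !low f row par !a : simpl nomatch.

(** * Loop invariants and running time of the machine *)

Section CliqueProgram.
Variables (inp : seq nat) (n k : nat).
(** Entry (v, m) of the adjacency matrix, which follows the two items [n] and [k]; [v * n + 2] is
    the row offset stored with a node. *)
Let adj_at : rel nat := fun m v => 0 < nth 0 inp (v * n + 2 + m).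
Local Notation ev := (reaches clique_program inp).

(** Node 0 is the empty clique and has no parent. By [i < j] the parent is always marked for the
    current vertex before the child is tested. *)
Definition listed (l : seq (seq nat)) (row par : nat -> nat) : Prop :=
  forall j, 0 < j < size l -> exists v i,
    [/\ i < j, row j = v * n + 2, par j = node i
      & nth [::] l j = v :: nth [::] l i].

(** A nonzero mark is the size of the clique after adding [m], which the machine compares with [k];
    it is nonzero even for the empty clique. *)
Definition marked (m i : nat) (l : seq (seq nat)) (f : nat -> nat) : Prop :=
  forall j, j < i -> f j =
    if all (adj_at m) (nth [::] l j) then (size (nth [::] l j)).+1 else 0.

Definition accepting (s : config) : Prop :=
  halted clique_program s /\ 0 < regs s 0.

Let short (s : seq nat) := size s < k.

(** Invariant of the outer loop, at instruction 7: no clique of size [k] has appeared yet, and the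
    marks left by the previous vertex are arbitrary. *)
Definition at_vertex (m : nat) (s : config) : Prop :=
  all short (cliques adj_at m) /\
  exists f row par x6 x7 x9 x10,
    s = Config 7 (memory [:: 0; 1; n; k; m; m * n + 2; x6; x7;
                            node (size (cliques adj_at m)); x9; x10] f row par)
    /\ listed (cliques adj_at m) row par.

Definition partial m i :=
  cliques adj_at m ++ extend adj_at m (take i (cliques adj_at m)).

(** Invariant of the inner loop, at instruction 22, once clique [i] has been processed for [m];
    hence the index [i.+1]. Register 7 ends the old nodes, register 8 the new ones. *)
Definition at_clique (m i : nat) (s : config) : Prop :=
  all short (partial m i.+1) /\
  exists f row par x9 x10,
    [/\ s = Config 22 (memory [:: 0; 1; n; k; m; m * n + 2; node i;
                              node (size (cliques adj_at m));
                              node (size (partial m i.+1)); x9; x10] f row par),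
        listed (partial m i.+1) row par
      & marked m i.+1 (cliques adj_at m) f].

Lemma partialS m i : i < size (cliques adj_at m) ->
  let s := nth [::] (cliques adj_at m) i in
  partial m i.+1 =
  if all (adj_at m) s then rcons (partial m i) (m :: s) else partial m i.
Proof.
move=> il s; rewrite /partial (take_nth [::]) // /extend filter_rcons.
by rewrite -/s; case: ifP => // _; rewrite map_rcons -rcons_cat.
Qed.

Lemma listed_rcons m i l row par :
  i < size l -> listed l row par ->
  listed (rcons l (m :: nth [::] l i)) (upd row (size l) (m * n + 2))
    (upd par (size l) (node i)).
Proof.
move=> il h j; rewrite size_rcons ltnS => /andP[j0].
rewrite leq_eqVlt => /predU1P[->|jl].
  by exists m, i; rewrite /upd eqxx !nth_rcons ltnn eqxx il.
have [v [a [aj rj pj nj]]] := h j (introT andP (conj j0 jl)).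
exists v, a; rewrite /upd ltn_eqF // !nth_rcons jl (ltn_trans aj jl).
by split.
Qed.

Ltac exec_instr :=
  first [ eapply exec_const; [reflexivity | reflexivity |]
        | eapply exec_add; [reflexivity | reflexivity |]
        | eapply exec_sub; [reflexivity | reflexivity |]
        | eapply exec_read; [reflexivity | reflexivity |]
        | eapply exec_fetch; [reflexivity | reflexivity |] ]; simpl.
Ltac jump := eapply exec_jump; [reflexivity | simpl | simpl].
Ltac nojump := eapply exec_nojump; [reflexivity | simpl | simpl].

Let accepts m s :=
  accepting s /\ has (fun s' => size s' == k) (cliques adj_at m.+1).

Lemma node3 j : node j + 1 + 1 + 1 = node j.+1.
Proof. rewrite !nodeE; lia. Qed.

Lemma extend_clique m i f row par x10 (l := cliques adj_at m) (s := nth [::] l i) :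
  i < size l -> all short (partial m i) -> all (adj_at m) s ->
  listed (partial m i) row par -> marked m i l f ->
  ev 12 (fun s' => accepts m s' \/ at_clique m i s')
     (Config 13 (memory [:: 0; 1; n; k; m; m * n + 2; node i; node (size l);
        node (size (partial m i)); (size s).+1; x10] f row par)).
Proof.
move=> il sh adjs li mk.
have shs : size s < k.
  by move: sh; rewrite all_cat => /andP[/allP /(_ s (mem_nth _ il))].
have mk' : marked m i.+1 l (upd f i (size s).+1).
  move=> j; rewrite ltnS leq_eqVlt /upd => /predU1P[->|ji].
    by rewrite eqxx -/s adjs.
  by rewrite ltn_eqF // mk.
eapply exec_store_size; [reflexivity|reflexivity|reflexivity|]; simpl.
exec_instr.
(* As [size s < k], the first case means that [m :: s] has exactly [k] vertices. *)
have [ks|ks] := leqP k (size s).+1.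
  nojump; first by apply/eqP.
  jump => //; exec_instr.
  apply: reaches_now; left; split => //.
  apply/hasP; exists (m :: s); last by rewrite /= eqn_leq ks shs.
  rewrite /= mem_cat; apply/orP; right; apply: map_f.
  by rewrite mem_filter adjs mem_nth.
jump; first by rewrite subn_gt0.
exec_instr.
eapply exec_store_row; [reflexivity|reflexivity|reflexivity|]; simpl.
exec_instr.
eapply exec_store_par; [reflexivity|reflexivity|reflexivity|]; simpl.
exec_instr.
apply: reaches_now; right; rewrite /at_clique partialS // -/s adjs; split.
  by rewrite all_rcons sh /short /= ks.
rewrite size_rcons node3; do 5 eexists; split; first by reflexivity.
  have -> : s = nth [::] (partial m i) i by rewrite nth_cat il.
  by apply: listed_rcons => //; rewrite size_cat (leq_trans il) ?leq_addr.
exact: mk'.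
Qed.

Lemma listed_partial m i row par :
  listed (partial m i) row par -> listed (cliques adj_at m) row par.
Proof.
move=> h j /andP[j0 jl].
have [|v [a [aj rj pj]]] := h j.
  by rewrite j0 size_cat (leq_trans jl) ?leq_addr.
by rewrite !nth_cat jl (ltn_trans aj jl); exists v, a.
Qed.

(** The time per clique is constant: for a clique with largest vertex [v], one input bit tells
    whether [v] is adjacent to [m], and the mark of the parent answers for all other vertices. The
    test takes at most 15 instructions, the update 12 at most. *)
Lemma next_clique m i s :
  i.+1 < size (cliques adj_at m) -> at_clique m i s ->
  ev 27 (fun s' => accepts m s' \/ at_clique m i.+1 s') s.
Proof.
move=> il [sh [f [row [par [x9 [x10 [-> li mk]]]]]]].
have [v [a [ai rowE parE nthE]]] := listed_partial li (il : 0 < i.+1 < _).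
have nodeS : node i + 3 = node i.+1 by rewrite !nodeE; lia.
(* Instructions 34 and 35 serve both failures, that of [v] and that of the parent; register 9 is 0
   in either case. *)
have skip x10' : ~~ all (adj_at m) (nth [::] (cliques adj_at m) i.+1) ->
   ev 12 (fun s' => accepts m s' \/ at_clique m i.+1 s')
     (Config 34 (memory [:: 0; 1; n; k; m; m * n + 2; node i.+1;
        node (size (cliques adj_at m)); node (size (partial m i.+1)); 0; x10'] f row par)).
  move=> nadj.
  eapply exec_store_size; [reflexivity|reflexivity|reflexivity|]; simpl.
  jump => //.
  apply: reaches_now; right; rewrite /at_clique partialS // (negbTE nadj).
  split => //; do 5 eexists; split; [by reflexivity|by []|].
  move=> j; rewrite ltnS leq_eqVlt /upd => /predU1P[->|ji].
    by rewrite eqxx (negbTE nadj).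
  by rewrite ltn_eqF // mk.
exec_instr; exec_instr; rewrite nodeS; exec_instr.
jump; first by rewrite subn_gt0 !nodeE; lia.
exec_instr; exec_instr; rewrite memory_row // rowE; exec_instr; exec_instr.
case vm: (adj_at m v); last first.
  nojump; first by move: vm; rewrite /adj_at lt0n => /negbFE/eqP.
  have -> : nth 0 inp (v * n + 2 + m) = 0.
    by move: vm; rewrite /adj_at lt0n => /negbFE/eqP.
  apply: reaches_weaken (skip _ _) => //; rewrite nthE /= vm //.
jump => //; exec_instr; exec_instr; rewrite memory_par // parE.
exec_instr; rewrite memory_size // mk //.
have := nthE; case: ifP => adjs nthE'; last first.
  nojump => //; jump => //.
  apply: reaches_weaken (skip _ _) => //; rewrite nthE' /= adjs andbF //.
jump => //; exec_instr; jump => //.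
rewrite addn1 -[(size _).+2]/((size (v :: _)).+1) -nthE'.
apply: reaches_weaken (extend_clique _ _ _ _ _ _) => //.
by rewrite nthE' /= vm adjs.
Qed.

Lemma end_pass m s (l := cliques adj_at m) :
  at_clique m (size l).-1 s -> ev 7 (at_vertex m.+1) s.
Proof.
have l0 : 0 < size l := size_cliques_gt0 _ m.
case=> sh [f [row [par [x9 [x10 [-> li mk]]]]]].
move: sh li; rewrite prednK // -/l.
have -> : partial m (size l) = cliques adj_at m.+1 by rewrite /partial take_size.
move=> sh li.
exec_instr; exec_instr; exec_instr.
nojump; first by apply/eqP; rewrite subn_eq0 !nodeE; lia.
exec_instr; exec_instr; jump => //.
apply: reaches_now; split => //.
rewrite addn1 addnAC -mulSnr; do 7 eexists; split; [by reflexivity|].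
exact: li.
Qed.

(** The empty clique extends by every vertex, so the pass enters at instruction 13 without a test;
    each further clique costs 27, and closing the pass costs 7. *)
Lemma vertex_pass m s (l := cliques adj_at m) : m < n -> at_vertex m s ->
  ev (27 * (size l).+1) (fun s' => accepts m s' \/ at_vertex m.+1 s') s.
Proof.
have l0 : 0 < size l := size_cliques_gt0 _ m.
move=> mn [sh [f [row [par [x6 [x7 [x9 [x10 [-> li]]]]]]]]].
pose Q s' := accepts m s' \/ at_vertex m.+1 s'.
have pass d i s' : i + d = (size l).-1 -> at_clique m i s' ->
    ev (27 * d + 7) Q s'.
  elim: d i s' => [|d IH] i s' idl h.
    apply: reaches_weaken (@end_pass m s' _) => // [s''|]; first by right.
    by rewrite -/l -idl addn0.
  have il : i.+1 < size l by lia.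
  have -> : 27 * d.+1 + 7 = 27 + (27 * d + 7) by lia.
  apply: reaches_trans (next_clique il h) _ => s'' [acc|].
    by apply: reaches_now; left.
  by apply: IH; lia.
have nth0l : nth [::] l 0 = [::].
  rewrite /l; elim: (m) => //= m' IH; rewrite nth_cat; case: ifP => //.
  by rewrite lt0n => /negbFE/eqP/size0nil e; rewrite e.
have part0 : partial m 0 = l by rewrite /partial take0 cats0.
have -> : 27 * (size l).+1 = 6 + (12 + (27 * (size l).-1 + 36)) by lia.
exec_instr; jump; first by rewrite subn_gt0.
exec_instr; exec_instr; exec_instr; rewrite addn0.
have := @extend_clique m 0 f row par (n - m) l0.
rewrite part0 -/l nth0l => /(_ sh isT li) h.
apply: (@reaches_weaken _ _ (12 + (27 * (size l).-1 + 36)) _ Q) => //.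
apply: reaches_trans (h _) _ => // s' [acc|nxt].
  by apply: reaches_now; left.
by apply: reaches_weaken (pass (size l).-1 0 s' _ nxt) => //; lia.
Qed.

(** Each of the [M] passes and the initialisation are charged with the final, largest number of
    short cliques. *)
Definition cost (M : nat) : nat :=
  27 * (M.+1 * (count short (cliques adj_at M)).+1).

Hypotheses (inp0 : nth 0 inp 0 = n) (inp1 : nth 0 inp 1 = k).

(** [M] is arbitrary so that an early acceptance is charged only for the vertices seen until
    then. *)
Lemma run_vertices M : M <= n ->
  ev (cost M)
    (fun s => accepting s /\ has (fun s' => size s' == k) (cliques adj_at M)
      \/ 0 < k /\ at_vertex M s)
    (Config 0 (fun=> 0)).
Proof.
have -> : (fun=> 0) = memory (nseq 11 0) (fun=> 0) (fun=> 0) (fun=> 0).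
  apply/funext => a; rewrite memoryE nth_nseq if_same.
  by case: ifP => // _; rewrite /nodes; case: (_ %% 3) => // [[]].
elim: M => [|M IH] Mn.
  rewrite /cost; set b := 27 * _; have -> : b = 9 + (b - 9) by rewrite /b; lia.
  exec_instr; exec_instr; rewrite inp0; exec_instr; rewrite inp1.
  (* For [k = 0] the empty clique is accepted before the loop starts. *)
  have [k0|k0] := posnP k.
    nojump => //; jump => //; exec_instr; apply: reaches_now; left; split => //.
    by rewrite k0.
  jump => //; exec_instr; exec_instr.
  apply: reaches_now; right; split => //; split; first by rewrite /= andbT.
  rewrite (_ : 14 = node 1) ?nodeE //.
  by do 7 eexists; split; [reflexivity | case=> [|[]]].
apply: (@reaches_weaken _ _
  (cost M + 27 * (count short (cliques adj_at M)).+1)).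
- by rewrite /cost -mulnDr -mulSnr leq_mul2l /= leq_mul // ltnS cliques_mono.
- by move=> ? h; exact: h.
apply: reaches_trans (IH (ltnW Mn)) _ => s [[acc hasM]|[k0 atM]].
  by apply: reaches_now; left; rewrite /= has_cat hasM.
(* Before acceptance all listed cliques are short, so a pass over the whole list is paid for by
   short cliques. *)
have -> : count short (cliques adj_at M) = size (cliques adj_at M).
  by apply/eqP; rewrite -all_count; case: atM.
apply: reaches_weaken (vertex_pass Mn atM) => // s'.
by case=> [|h]; [left|right].
Qed.

Lemma cost_geq M : 27 <= cost M.
Proof. by rewrite /cost leq_pmulr // muln_gt0. Qed.

Lemma halts_accepting M : M <= n ->
  has (fun s => size s == k) (cliques adj_at M) ->
  ev (cost M) accepting (Config 0 (fun=> 0)).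
Proof.
move=> Mn hasM; apply: reaches_weaken (run_vertices Mn) => // s [[]//|].
case=> _ [/allP sh _]; case/hasP: hasM => s' /sh + /eqP e.
by rewrite /short e ltnn.
Qed.

Lemma halts : ev (2 * cost n)
  (fun s => halted clique_program s /\
    (0 < regs s 0) = has (fun s' => size s' == k) (cliques adj_at n))
  (Config 0 (fun=> 0)).
Proof.
rewrite mul2n -addnn.
apply: reaches_trans (run_vertices (leqnn n)) _ => s [[[hs out] hask]|[_ [sh]]].
  by apply: reaches_now; rewrite out hask.
case=> f [row [par [x6 [x7 [x9 [x10 [-> _]]]]]]].
(* The second [cost n] pays for the three instructions that leave the loop after the last vertex. *)
have -> : cost n = 3 + (cost n - 3) by have := cost_geq n; lia.
exec_instr; nojump; first by rewrite subnn.
jump => //; apply: reaches_now; split => //=.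
apply/esym/negbTE/hasPn => s' /(allP sh); rewrite /short; lia.
Qed.
End CliqueProgram.

(** * Graphs *)

Lemma nth_flatten_uniform (T : Type) (x0 : T) (n : nat) (ss : seq (seq T)) i j :
  all (fun s => size s == n) ss -> j < n ->
  nth x0 (flatten ss) (i * n + j) = nth x0 (nth [::] ss i) j.
Proof.
move=> + jn; elim: ss i => [|s ss IH] i /=; first by rewrite !nth_nil.
case/andP => /eqP sn ssn; rewrite nth_cat sn.
case: i => [|i] /=; first by rewrite mul0n add0n jn.
by rewrite mulSn -addnA ltnNge leq_addr /= addKn IH.
Qed.

Section Graphs.
Variable n : nat.
Implicit Types (G : graph n) (S : {set 'I_n}) (s : seq nat).

Lemma adj_sym G : symmetric (adj G).
Proof. by move=> i j; rewrite /adj finset.setUC. Qed.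

Lemma nth_encode G k (i j : 'I_n) :
  nth 0 (encode G k) (i * n + 2 + j) = adj G i j.
Proof.
rewrite addnAC addn2 /encode /= nth_flatten_uniform //.
  rewrite (nth_map i) ?size_enum_ord // (nth_map i) ?size_enum_ord //.
  by rewrite !nth_ord_enum.
by apply/allP => _ /mapP[x _ ->]; rewrite size_map size_enum_ord.
Qed.

Definition edges_in S : {set edge n} := [set e : edge n | val e \subset S].

Lemma card_edges_in S : #|edges_in S| = 'C(#|S|, 2).
Proof.
rewrite -cards_draws -(card_imset _ val_inj); apply: eq_card => e.
rewrite inE; apply/imsetP/andP => [[e' + ->]|[eS e2]].
  by rewrite inE => ->; split=> //; exact: (valP e').
by exists (eqtype.Sub e e2 : edge n); rewrite ?inE SubK.
Qed.

Lemma adj_in G (i j : 'I_n) (ij : #|[set i; j]%SET| == 2) :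
  adj G i j = ((eqtype.Sub [set i; j]%SET ij : edge n) \in G).
Proof.
apply/existsP/idP => [[e /andP[eG /eqP eE]]|ijG].
  have -> : (eqtype.Sub [set i; j]%SET ij : edge n) = e.
    by apply/val_inj; rewrite SubK eE.
  exact: eG.
by exists (eqtype.Sub [set i; j]%SET ij); apply/andP; split; rewrite ?SubK.
Qed.

(** Reduces probabilities of cliques to those of inclusions of edge sets. *)
Lemma clique_subset G S : clique G S = (edges_in S \subset G).
Proof.
apply/forall_inP/fintype.subsetP => [cl e|sub i iS].
  have e2 : #|val e| == 2 := valP e.
  rewrite inE => eS; have /cards2P[i [j [ij eE]]] := e2.
  have ij2 : #|[set i; j]%SET| == 2 by rewrite cards2 ij.
  have -> : e = eqtype.Sub [set i; j]%SET ij2 by apply/val_inj; rewrite SubK eE.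
  move: eS; rewrite eE finset.subUset !finset.sub1set => /andP[iS jS].
  by rewrite -adj_in; move/forall_inP: (cl i iS) => /(_ j jS)/implyP; apply.
apply/forall_inP => j jS; apply/implyP => ij.
have ij2 : #|[set i; j]%SET| == 2 by rewrite cards2 ij.
by rewrite (adj_in G ij2); apply: sub; rewrite inE SubK finset.subUset !finset.sub1set iS.
Qed.

Definition vertices s : {set 'I_n} := [set i : 'I_n | val i \in s]%SET.

Lemma card_vertices s :
  uniq s -> all (fun v => v < n) s -> #|vertices s| = size s.
Proof.
move=> us /allP sn; rewrite cardE -(size_map val); apply: perm_size.
apply: uniq_perm => //; first by rewrite map_inj_uniq ?enum_uniq //; apply: val_inj.
move=> v; apply/mapP/idP => [[i + ->]|vs]; first by rewrite mem_enum inE.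
by exists (Ordinal (sn v vs)); rewrite ?mem_enum ?inE.
Qed.

Definition adj_nat G k : rel nat :=
  fun m v => 0 < nth 0 (encode G k) (v * n + 2 + m).

Lemma pairwise_adj G k s : uniq s -> all (fun v => v < n) s ->
  pairwise (adj_nat G k) s = clique G (vertices s).
Proof.
have adjE (i j : 'I_n) : adj_nat G k i j = adj G i j.
  by rewrite /adj_nat nth_encode adj_sym; case: adj.
elim: s => [|a s IH] /=.
  by move=> _ _; apply/esym/forall_inP => i; rewrite inE.
case/andP => a_s us /andP[an sn]; rewrite IH //; apply/andP/forall_inP.
  case=> /allP as_ /forall_inP cl i + ; rewrite !inE => ia.
  apply/forall_inP => j; rewrite !inE => ja; apply/implyP.
  case/predU1P: ia => ia; case/predU1P: ja => ja ij.
  - by case/eqP: ij; apply/val_inj; rewrite ia ja.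
  - by rewrite -adjE ia; apply: as_.
  - by rewrite adj_sym -adjE ja; apply: as_.
  - have := cl i; rewrite inE => /(_ ia)/forall_inP/(_ j).
    by rewrite inE => /(_ ja)/implyP; apply.
move=> cl; split.
  apply/allP => v vs; have vn := allP sn v vs.
  rewrite -[a]/(val (Ordinal an)) -[v]/(val (Ordinal vn)) adjE.
  have := cl (Ordinal an); rewrite !inE /= eqxx => /(_ isT)/forall_inP.
  move=> /(_ (Ordinal vn)); rewrite !inE /= vs orbT => /(_ isT)/implyP; apply.
  by apply: contraNneq a_s => -[->].
apply/forall_inP => i; rewrite inE => is_; apply/forall_inP => j; rewrite inE => js.
have := cl i; rewrite !inE is_ orbT => /(_ isT)/forall_inP/(_ j).
by rewrite !inE js orbT; apply.
Qed.

Lemma declists_uniq m s : s \in declists m -> uniq s.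
Proof.
rewrite mem_declists => /andP[+ _]; rewrite gtn_sorted_uniq_geq.
by case/andP.
Qed.

Lemma declists_lt m s : m <= n -> s \in declists m -> all (fun v => v < n) s.
Proof.
move=> mn; rewrite mem_declists => /andP[_]; apply: sub_all => v vm.
exact: leq_trans mn.
Qed.

Lemma mem_cliques G k m s : m <= n ->
  (s \in cliques (adj_nat G k) m) = (s \in declists m) && clique G (vertices s).
Proof.
move=> mn; rewrite cliques_filter mem_filter andbC.
case sm: (s \in declists m) => //=.
by rewrite pairwise_adj ?(declists_uniq sm) ?(declists_lt mn sm).
Qed.

Lemma has_cliques G k k' :
  has (fun s => size s == k) (cliques (adj_nat G k') n) = has_clique G k.
Proof.
apply/hasP/existsP => [[s]|[S /andP[/eqP Sk cl]]].
  rewrite mem_cliques // => /andP[sn cl] /eqP <-; exists (vertices s).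
  by rewrite cl card_vertices ?eqxx ?(declists_uniq sn) ?(declists_lt _ sn).
pose s := sort geq [seq val i | i <- enum S].
have SE : vertices s = S.
  apply/finset.setP => i; rewrite inE mem_sort.
  by rewrite (mem_map val_inj) mem_enum.
exists s; last by rewrite size_sort size_map -cardE Sk.
rewrite mem_cliques // SE cl andbT mem_declists.
rewrite gtn_sorted_uniq_geq sort_uniq map_inj_uniq ?enum_uniq //=; last exact: val_inj.
rewrite sort_sorted /=; last by move=> a b; exact: leq_total.
by apply/allP => v; rewrite mem_sort => /mapP[i _ ->]; exact: ltn_ord.
Qed.

(** * Disjoint blocks of vertices *)

Definition block k i : seq nat := rev (iota (i * k) k).

Lemma mem_block k i v : (v \in block k i) = (i * k <= v < i.+1 * k).
Proof. by rewrite mem_rev mem_iota mulSnr. Qed.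

Lemma block_declists k i m : i.+1 * k <= m -> block k i \in declists m.
Proof.
move=> ikm; rewrite mem_declists; apply/andP; split.
  by rewrite /block rev_sorted; exact: iota_ltn_sorted.
apply/allP => v; rewrite mem_block => /andP[_ h]; exact: leq_trans ikm.
Qed.

(** This is what makes the events that the single blocks are cliques independent. *)
Lemma block_edges_disjoint k i j : i < j ->
  [disjoint edges_in (vertices (block k i)) & edges_in (vertices (block k j))].
Proof.
move=> ij; rewrite -finset.setI_eq0; apply/eqP/finset.setP => e; rewrite !inE.
apply/negbTE/negP => /andP[/fintype.subsetP ei /fintype.subsetP ej].
have e2 : #|val e| == 2 := valP e.
have /cards2P[x [y [_ eE]]] := e2.
have xe : x \in val e by rewrite eE !inE eqxx.
have := ei _ xe; have := ej _ xe; rewrite !inE !mem_block => /andP[h1 _] /andP[_ h2].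
by have := leq_trans h2 (leq_trans (leq_mul ij (leqnn k)) h1); rewrite ltnn.
Qed.

End Graphs.

Local Open Scope ring_scope.

(** * Random graphs *)

Section RandomGraph.
Variables (R : realType) (n : nat) (p : R).
Implicit Types (G : graph n) (F : {set edge n}).

Lemma gnp_ge0 G : 0 <= p <= 1 -> 0 <= gnp p G.
Proof.
case/andP=> p0 p1; apply: prodr_ge0 => e _.
by case: ifP => // _; rewrite subr_ge0.
Qed.

(** Expand the product of all [p + h e], with [h] equal to 0 on [F] and to [1 - p] elsewhere, over
    the set [G] of edges that contribute [p]: the terms with [F] not inside [G] vanish. *)
Lemma gnp_supset F :
  \sum_(G : graph n) gnp p G * (F \subset G)%:R = p ^+ #|F|.
Proof.
pose h (e : edge n) : R := if e \in F then 0 else 1 - p.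
have -> : p ^+ #|F| = \prod_(e : edge n) (p + h e).
  rewrite (bigID [in F]) /= [X in _ * X]big1 ?mulr1 => [|e /negbTE eF].
    rewrite (eq_bigr (fun=> p)) ?prodr_const // => e eF.
    by rewrite /h eF addr0.
  by rewrite /h eF addrC subrK.
rewrite bigA_distr; apply: eq_bigr => G _.
have [FG|] := boolP (F \subset G).
  rewrite mulr1; apply: eq_bigr => e _; case: ifP => // eG.
  by rewrite /h ifF //; apply: contraFF eG => /(fintype.subsetP FG).
case/subsetPn => e eF eG; rewrite mulr0 (bigD1 e) //= (negbTE eG) /h eF.
by rewrite mul0r.
Qed.

Lemma gnp_total : \sum_(G : graph n) gnp p G = 1.
Proof.
transitivity (p ^+ #|(finset.set0 : {set edge n})|); last by rewrite cards0.
by rewrite -gnp_supset; apply: eq_bigr => G _; rewrite finset.sub0set mulr1.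
Qed.

(** Independence of disjoint edge sets by induction: the factor of [F'] splits the sum into the one
    for [F] minus the one for the union of [F] and [F']. This is why a general [F] is carried
    along. *)
Lemma gnp_avoid q F (Fs : seq {set edge n}) :
  all (fun F' => #|F'| == q) Fs ->
  pairwise (fun F1 F2 : {set edge n} => [disjoint F1 & F2]) (F :: Fs) ->
  \sum_(G : graph n)
     gnp p G * (F \subset G)%:R * \prod_(F' <- Fs) (1 - (F' \subset G)%:R) =
  p ^+ #|F| * (1 - p ^+ q) ^+ size Fs.
Proof.
elim: Fs F => [|F' Fs IH] F.
  move=> _ _; rewrite mulr1 -gnp_supset; apply: eq_bigr => G _.
  by rewrite big_nil mulr1.
move=> /andP[/eqP F'q Fsq] /= /andP[/andP[FF' FFs] /andP[F'Fs dFs]].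
transitivity (p ^+ #|F| * (1 - p ^+ q) ^+ size Fs -
              p ^+ #|F :|: F'| * (1 - p ^+ q) ^+ size Fs).
  have FF's : all (fun F2 : {set edge n} => [disjoint F :|: F' & F2]) Fs.
    apply/allP => F1 F1Fs; rewrite -finset.setI_eq0.
    rewrite finset.setIUl finset.setU_eq0 !finset.setI_eq0.
    by rewrite (allP FFs) ?(allP F'Fs).
  rewrite -(IH F) -?(IH (F :|: F')) //= ?FFs ?FF's //.
  rewrite -sumrB; apply: eq_bigr => G _; rewrite big_cons finset.subUset.
  by case: (F \subset G); case: (F' \subset G) => /=; ring.
rewrite cardsU (eqP (_ : F :&: F' == finset.set0)) ?finset.setI_eq0 //.
rewrite cards0 subn0 F'q exprD (exprS _ (size Fs)).
by move: (p ^+ #|F|) (p ^+ q) (_ ^+ size Fs) => x y z; ring.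
Qed.

(** Linearity of expectation over all decreasing lists, which are then grouped by size. *)
Lemma expected_cliques k :
  \sum_(G : graph n) gnp p G * (size (cliques (adj_nat G k) n))%:R =
  \sum_(j < n.+1) 'C(n, j)%:R * p ^+ 'C(j, 2).
Proof.
transitivity (\sum_(s <- declists n) p ^+ 'C(size s, 2)).
  transitivity (\sum_(G : graph n) \sum_(s <- declists n)
     gnp p G * (edges_in (vertices n s) \subset G)%:R).
    apply: eq_bigr => G _; rewrite -mulr_sumr; congr (_ * _).
    rewrite cliques_filter size_filter -sum1_count natr_sum big_mkcond.
    rewrite !big_seq; apply: eq_bigr => s sn.
    rewrite -clique_subset pairwise_adj ?(declists_uniq sn) ?(declists_lt _ sn) //.
    by case: clique.
  rewrite exchange_big /= !big_seq; apply: eq_bigr => s sn.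
  rewrite gnp_supset card_edges_in card_vertices ?(declists_uniq sn) //.
  by rewrite (declists_lt _ sn).
transitivity (\sum_(s <- declists n) \sum_(j < n.+1)
   (size s == j)%:R * p ^+ 'C(j, 2)).
  rewrite !big_seq; apply: eq_bigr => s sn.
  have szn : (size s < n.+1)%N.
    rewrite ltnS -[X in (_ <= X)%N](size_iota 0); apply: uniq_leq_size.
      exact: declists_uniq sn.
    by move=> v vs; rewrite mem_iota (allP (declists_lt (leqnn n) sn)).
  rewrite (bigD1 (Ordinal szn)) //= eqxx mul1r big1 ?addr0 // => j jn.
  by rewrite eq_sym (negbTE (_ : j != size s :> nat)%N) ?mul0r.
rewrite exchange_big /=; apply: eq_bigr => j _.
rewrite -mulr_suml; congr (_ * _).
rewrite -count_size_declists -sum1_count natr_sum [RHS]big_mkcond.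
by apply: eq_bigr => s _; case: eqP.
Qed.

Lemma bin_leq_exp (a b : nat) : ('C(a, b) <= a ^ b)%N.
Proof.
elim: b => [|b IH]; first by rewrite bin0.
have : (b.+1 * 'C(a, b.+1) = (a - b) * 'C(a, b))%N by rewrite mul_bin_left.
move=> e; apply: (@leq_trans (b.+1 * 'C(a, b.+1))%N); first exact: leq_pmull.
by rewrite e expnS leq_mul // leq_subr.
Qed.

(** Each size up to [d] contributes at most [n ^ d], each larger size at most 1. *)
Lemma expected_cliques_sparse k d :
  (0 < n)%N -> 0 <= p <= 1 -> p ^+ d * n%:R ^+ 2 <= 1 ->
  \sum_(G : graph n) gnp p G * (size (cliques (adj_nat G k) n))%:R <=
  n.+1%:R * n%:R ^+ d.
Proof.
move=> n0 /andP[p0 p1] sparse; rewrite expected_cliques.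
have n1 : 1 <= n%:R :> R by rewrite ler1n.
have -> : n.+1%:R * n%:R ^+ d = \sum_(j < n.+1) n%:R ^+ d :> R.
  by rewrite sumr_const card_ord mulr_natl.
apply: ler_sum => j _.
apply: (@le_trans _ _ (n%:R ^+ j * p ^+ 'C(j, 2))).
  by rewrite ler_wpM2r ?exprn_ge0 // -natrX ler_nat bin_leq_exp.
have [jd|dj] := leqP j d.
  rewrite -[leRHS]mulr1; apply: ler_pM; rewrite ?exprn_ge0 ?ler0n //.
    exact: ler_weXn2l.
  exact: exprn_ile1.
apply: (@le_trans _ _ 1); last exact: exprn_ege1.
have nn0 : 0 <= n%:R ^+ j * p ^+ 'C(j, 2) by rewrite mulr_ge0 ?exprn_ge0.
(* Squaring turns the exponent C(j, 2) into j(j-1), which is at least jd; the square is thus at most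
   the j-th power of [p ^+ d * n%:R ^+ 2]. *)
rewrite -(@expr_le1 _ 2) // exprMn -!exprM.
have -> : ('C(j, 2) * 2 = j * j.-1)%N by rewrite (bin_ffact j 2) ffactnS ffactn1.
apply: (@le_trans _ _ ((p ^+ d * n%:R ^+ 2) ^+ j)); last first.
  by rewrite exprn_ile1 // mulr_ge0 ?exprn_ge0.
rewrite exprMn -!exprM mulrC (mulnC 2) ler_wpM2r ?exprn_ge0 //.
apply: ler_wiXn2l => //; rewrite mulnC leq_mul2l; lia.
Qed.

Lemma no_block_clique k b :
  (b * k <= n)%N ->
  \sum_(G : graph n) gnp p G *
     (~~ has (fun i => clique G (vertices n (block k i))) (iota 0 b))%:R =
  (1 - p ^+ 'C(k, 2)) ^+ b.
Proof.
move=> bkn.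
pose Fs := [seq edges_in (vertices n (block k i)) | i <- iota 0 b].
have sz : size Fs = b by rewrite size_map size_iota.
transitivity (p ^+ #|(finset.set0 : {set edge n})| *
              (1 - p ^+ 'C(k, 2)) ^+ size Fs); last by rewrite cards0 mul1r sz.
rewrite -gnp_avoid; first last.
- rewrite pairwise_cons; apply/andP; split.
    by apply/allP => F _; rewrite -finset.setI_eq0 finset.set0I.
  rewrite pairwise_map; have := iota_ltn_sorted 0 b.
  rewrite sorted_pairwise; last exact: ltn_trans.
  apply: sub_pairwise => i j ij /=; exact: block_edges_disjoint.
- apply/allP => _ /mapP[i + ->]; rewrite mem_iota add0n => /andP[_ ib].
  have ik : (i.+1 * k <= n)%N by apply: leq_trans bkn; rewrite leq_mul2r ib orbT.
  have bd := block_declists ik.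
  by rewrite card_edges_in card_vertices ?(declists_uniq bd) ?(declists_lt _ bd)
     // size_rev size_iota.
apply: eq_bigr => G _; rewrite finset.sub0set mulr1; congr (_ * _).
rewrite big_map; elim: (iota 0 b) => [|i l IH] /=; first by rewrite big_nil.
by rewrite big_cons -IH clique_subset; case: (_ \subset _);
  rewrite ?subrr ?mul0r ?subr0 ?mul1r.
Qed.

End RandomGraph.

(** * Average running time *)

(** What the case lim g > 0 or p = 0 provides; [subpoly_dense] is its counterpart for lim g = 0. *)
Definition poly_sparse (R : realType) (p : nat -> R) : Prop :=
  exists d n0 : nat, forall n, (n0 <= n)%N -> (0 < n)%N ->
    p n ^+ d * n%:R ^+ 2 <= 1.

Definition subpoly_dense (R : realType) (p : nat -> R) : Prop :=
  forall d : nat, exists n0 : nat, forall n, (n0 <= n)%N -> (0 < n)%N ->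
    1 <= p n ^+ d * n%:R.

Lemma natural_sparse_or_dense (R : realType) (p : nat -> R) :
  natural_function p -> poly_sparse p \/ subpoly_dense p.
Proof.
case=> [p0|[g [g0 cg pE]]].
  by left; exists 1%N, 0%N => n _ n0; rewrite p0 // expr1 mul0r.
have l0 : 0 <= limn g by apply: limr_ge => //; apply: nearW.
have powE d n c : (0 < n)%N ->
    p n ^+ d * n%:R ^+ c = n%:R `^ (c%:R - g n * d%:R) :> R.
  move=> n0; rewrite pE // -(powR_mulrn _ (powR_ge0 _ _)) -powRrM.
  rewrite -(powR_mulrn c) ?ler0n // -powRD; last first.
    by rewrite pnatr_eq0 -lt0n n0 implybT.
  by congr (_ `^ _); ring.
have [l_gt0|] := ltP 0 (limn g).
  (* Eventually [g n] exceeds half its limit, so [g n * d] exceeds 2 and the exponent of [n] is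
     negative. *)
  left; pose d := (Num.bound (4 / limn g)).
  have [n0 _ n0P] : (\forall n \near \oo, limn g / 2 < g n)%classic.
    by apply: (cvgr_gt (limn g)) => //; lra.
  exists d, n0 => n n0n n1; rewrite powE //.
  rewrite -[leRHS](powRr0 n%:R); apply: ler_powR; first by rewrite ler1n.
  have := n0P n n0n => /= gn.
  have : 4 / limn g < d%:R.
    by have := archi_boundP (_ : 0 <= 4 / limn g); apply; rewrite divr_ge0.
  rewrite ltr_pdivrMr // => hd.
  have d0 : 0 <= d%:R :> R by [].
  nra.
move=> l_le0; have l_eq0 : limn g = 0 by apply: le_anti; rewrite l_le0.
right=> d; have d1 : 0 < d.+1%:R^-1 :> R by rewrite invr_gt0.
have [n0 _ n0P] : (\forall n \near \oo, g n < d.+1%:R^-1)%classic.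
  by apply: (cvgr_lt (limn g)) => //; rewrite l_eq0.
exists n0 => n n0n n1; rewrite -[n%:R]expr1 powE //.
rewrite -[leLHS](powRr0 n%:R); apply: ler_powR; first by rewrite ler1n.
have := n0P n n0n => /= gn.
rewrite subr_ge0; apply: (@le_trans _ _ (d.+1%:R^-1 * d%:R)).
  by rewrite ler_wpM2r // ltW.
by rewrite mulrC ler_pdivrMr // mul1r ler_nat.
Qed.

(** Telescoping, from 1/(x+1)^2 <= 1/x - 1/(x+1). *)
Lemma inverse_squares_sum (R : realType) N :
  \sum_(1 <= n < N.+2) (n%:R ^- 2 : R) <= 2 - N.+1%:R^-1.
Proof.
elim: N => [|N IH]; first by rewrite big_nat1 expr1n invr1; lra.
rewrite big_nat_recr //=; apply: le_trans (lerD IH (lexx _)) _.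
have N0 : 0 < N.+1%:R :> R by [].
have -> : N.+2%:R = N.+1%:R + 1 :> R by rewrite -natr1.
move: (N.+1%:R) N0 => x x0; have x1 : 0 < x + 1 by lra.
rewrite -subr_ge0.
have -> : 2 - (x + 1)^-1 - (2 - x^-1 + (x + 1) ^- 2) =
          x^-1 * (x + 1)^-1 * (x + 1)^-1.
  by field; rewrite !gt_eqF.
by rewrite !mulr_ge0 // invr_ge0 ltW.
Qed.

Lemma nneseries_inverse_squares_lt_pinfty (R : realType) (e : nat -> \bar R)
    (v : nat -> R) (K : R) (n0 : nat) :
  (forall n, 0 <= e n)%E -> (forall n, 0 <= v n) ->
  (forall n, (0 < n)%N -> (e n <= (v n * n%:R ^- 2)%:E)%E) ->
  (forall n, (n0 <= n)%N -> v n <= K) ->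
  (\sum_(1 <= n <oo) e n < +oo)%E.
Proof.
(* [K'] also dominates the finitely many values below [n0]. *)
move=> e0 v0 ev vK; pose K' := `|K| + \sum_(0 <= n < n0) v n.
have vK' n : v n <= K'.
  have [/vK h|nn0] := leqP n0 n.
    by rewrite (le_trans h) // (le_trans (ler_norm K)) // lerDl sumr_ge0.
  rewrite (le_trans _ (_ : \sum_(0 <= n < n0) v n <= _)) //; last by rewrite lerDr.
  by rewrite big_mkord (bigD1 (Ordinal nn0)) //= lerDl sumr_ge0.
have K'0 : 0 <= K' := le_trans (v0 0%N) (vK' 0%N).
apply: (@le_lt_trans _ _ (K' * 2)%:E); last exact: ltry.
apply: lime_le; first by apply: is_cvg_nneseries => n _ _.
apply: nearW => N; have eN : (\sum_(1 <= n < N) e n <= \sum_(1 <= n < N.+2) e n)%E.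
  case: N => [|N]; first by rewrite big_geq // sume_ge0.
  rewrite [leRHS](@big_cat_nat _ _ _ N.+1) //=; last by rewrite leqW.
  by rewrite leeDl // sume_ge0.
apply: (le_trans eN).
apply: (@le_trans _ _ (\sum_(1 <= n < N.+2) (K' * n%:R ^- 2)%:E)%E).
  rewrite !big_nat; apply: lee_sum => n /andP[n1 _].
  apply: (le_trans (ev n n1)); rewrite lee_fin.
  by apply: ler_wpM2r => //; rewrite invr_ge0 exprn_ge0.
rewrite sumEFin lee_fin -mulr_sumr ler_wpM2l //.
apply: (le_trans (inverse_squares_sum R N)).
by rewrite lerBlDr lerDl invr_ge0.
Qed.

Lemma running_time_le (R : realType) A inp t Q :
  reaches A inp t (fun s => halted A s /\ Q s) (Config 0 (fun=> 0%N)) ->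
  (running_time R A inp <= t%:R%:E)%E.
Proof.
case=> t' tt' [h _]; apply: (@le_trans _ _ t'%:R%:E).
  by apply: ereal_inf_lbound; exists t'.
by rewrite lee_fin ler_nat.
Qed.

Lemma running_time_ge0 (R : realType) A inp : (0 <= running_time R A inp)%E.
Proof. by apply: le_ereal_inf_tmp => _ [t _ <-]; rewrite lee_fin. Qed.

Lemma clique_program_decides : decides_clique clique_program.
Proof.
move=> n G k; have [t _ [ht out]] := @halts (encode G k) n k erefl erefl.
by exists t; split => //; rewrite -(has_cliques G k k).
Qed.

(** It suffices to bound the mean time for large [n] by a polynomial whose degree does not depend on
    [k]: dividing by [n ^ (c + 2)] leaves a multiple of the summable 1/n^2. *)
Lemma avgFPT_clique_program (R : realType) (p : nat -> R) (c : nat) :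
  (forall n, 0 <= p n <= 1) ->
  (forall k, exists (K : R) (n0 : nat), forall n, (n0 <= n)%N -> (0 < n)%N ->
     exists t : graph n -> R,
       (forall G, running_time R clique_program (encode G k) <= (t G)%:E)%E /\
       \sum_(G : graph n) gnp (p n) G * t G <= K * n%:R ^+ c) ->
  avgFPT_time p clique_program.
Proof.
move=> p01 H; exists c.+2.
pose e k n := gnp_expectation (p n) (fun G : graph n =>
  running_time R clique_program (encode G k) / (n%:R ^+ c.+2)%:E)%E.
have e0 k n : (0 <= e k n)%E.
  apply: sume_ge0 => G _; apply: mule_ge0; first by rewrite lee_fin gnp_ge0.
  by rewrite mule_ge0 ?running_time_ge0 // inve_ge0 lee_fin exprn_ge0.
suff fin k : (\sum_(1 <= n <oo) e k n < +oo)%E.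
  have /choice[f fP] k : exists m : nat, (\sum_(1 <= n <oo) e k n < m%:R%:E)%E.
    move: (fin k); have : (0 <= \sum_(1 <= n <oo) e k n)%E.
      by apply: nneseries_ge0 => n _ _; exact: e0.
    case: (limn _) => // r r0 _; exists (Num.bound r).
    by rewrite lte_fin archi_boundP.
  by exists f => k; exact: fP.
have [K [n0 Kn0]] := H k.
have tv n : exists v : R, [/\ 0 <= v, (n0 <= n)%N -> v <= `|K| &
    (0 < n)%N -> (e k n <= (v * n%:R ^- 2)%:E)%E].
  have [->|n1] := posnP n; first by exists 0.
  have tP (t : graph n -> R) :
     (forall G, running_time R clique_program (encode G k) <= (t G)%:E)%E ->
     (e k n <= ((\sum_(G : graph n) gnp (p n) G * t G) / n%:R ^+ c * n%:R ^- 2)%:E)%E.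
    move=> tG; rewrite /e /gnp_expectation -mulrA -invfM -exprD addn2 mulr_suml -sumEFin.
    apply: lee_sum => G _; rewrite -mulrA [leRHS]EFinM; apply: lee_wpmul2l.
      by rewrite lee_fin gnp_ge0.
    rewrite inver gt_eqF ?exprn_gt0 ?ltr0n // [leRHS]EFinM; apply: lee_wpmul2r; last exact: tG.
    by rewrite lee_fin invr_ge0 exprn_ge0.
  have v0 t : (forall G, running_time R clique_program (encode G k) <= (t G)%:E)%E ->
     0 <= (\sum_(G : graph n) gnp (p n) G * t G) / n%:R ^+ c.
    move=> tG; rewrite divr_ge0 ?exprn_ge0 // sumr_ge0 // => G _.
    rewrite mulr_ge0 ?gnp_ge0 // -lee_fin; apply: le_trans (tG G).
    exact: running_time_ge0.
  have [n0n|nn0] := leqP n0 n.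
    have [t [tG tK]] := Kn0 n n0n n1; eexists; split; [exact: v0 tG| |].
      move=> _; rewrite ler_pdivrMr ?exprn_gt0 ?ltr0n //; apply: (le_trans tK).
      by rewrite ler_wpM2r ?exprn_ge0 // ler_norm.
    by move=> _; exact: tP.
  (* For small [n] it is enough that the mean is finite, since the machine always halts. *)
  have tG G := running_time_le R (@halts (encode G k) n k erefl erefl).
  eexists; split; [exact: v0 tG| by [] |].
  by move=> _; exact: tP.
have [v vP] := choice tv.
apply: (@nneseries_inverse_squares_lt_pinfty _ (e k) v `|K| n0) => // n.
- by case: (vP n).
- by move=> n1; case: (vP n) => _ _; apply.
- by move=> n1; case: (vP n) => _ + _; apply.
Qed.

(** * The sparse case *)

Lemma cost_size n (G : graph n) k : (0 < n)%N ->
  (2 * cost (encode G k) n k n <= 216 * n * size (cliques (adj_nat G k) n))%N.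
Proof.
(* The empty clique is always listed, so the number of cliques plus 1 is at most twice that number;
   likewise n+1 <= 2n, and 216 is 2 * 27 * 2 * 2. *)
move=> n0; have s0 := size_cliques_gt0 (adj_nat G k) n.
have : (cost (encode G k) n k n <= 27 * (n.+1 * (size (cliques (adj_nat G k) n)).+1))%N.
  by rewrite /cost !leq_mul // ltnS count_size.
move: (cost _ _ _ _) (size _) s0 => a b b0 h; nia.
Qed.

Lemma cost_exp n (G : graph n) k M :
  (cost (encode G k) n k M <= 54 * M.+1 ^ k.+1)%N.
Proof.
apply: (@leq_trans (27 * (M.+1 * (M.+1 ^ k).+1))).
  by rewrite /cost !leq_mul // ltnS count_short_cliques.
have : (0 < M.+1 ^ k)%N by rewrite expn_gt0.
by rewrite expnS; move: (M.+1 ^ k)%N => x; nia.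
Qed.

Lemma sparse_avgFPT (R : realType) (p : nat -> R) :
  (forall n, 0 <= p n <= 1) -> poly_sparse p -> avgFPT_time p clique_program.
Proof.
move=> p01 [d [n0 sp]].
apply: (@avgFPT_clique_program _ _ d.+2) => // k.
(* The mean number of cliques is at most (n+1) n^d <= 2 n^(d+1), to be multiplied by 216n. *)
exists 432%:R, n0 => n n0n n1.
exists (fun G => (2 * cost (encode G k) n k n)%:R); split=> [G|].
  exact: running_time_le (@halts (encode G k) n k erefl erefl).
apply: (@le_trans _ _ ((216 * n)%:R *
  \sum_(G : graph n) gnp (p n) G * (size (cliques (adj_nat G k) n))%:R)).
  rewrite mulr_sumr; apply: ler_sum => G _.
  rewrite mulrCA ler_wpM2l ?gnp_ge0 // -natrM ler_nat.
  exact: cost_size.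
have h := expected_cliques_sparse k n1 (p01 n) (sp n n0n n1).
apply: (@le_trans _ _ ((216 * n)%:R * (n.+1%:R * n%:R ^+ d))).
  by rewrite ler_wpM2l.
have -> : 432%:R * n%:R ^+ d.+2 = (216 * n)%:R * ((2 * n)%:R * n%:R ^+ d) :> R.
  by rewrite !exprS !natrM; ring.
by rewrite ler_wpM2l // ler_wpM2r ?exprn_ge0 // ler_nat; lia.
Qed.

(** * The dense case *)

Lemma expr_1B_le (R : realType) (q : R) b : 0 <= q <= 1 ->
  (1 - q) ^+ b * (q * b%:R) <= 1.
Proof.
(* With 1 + qb the bound passes through induction, as (1-q)(1+q(b+1)) <= 1+qb. *)
move=> /andP[q0 q1]; apply: (@le_trans _ _ ((1 - q) ^+ b * (1 + q * b%:R))).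
  by rewrite ler_wpM2l ?exprn_ge0 ?subr_ge0 // lerDr.
elim: b => [|b IH]; first by rewrite mulr0 addr0 mulr1.
apply: le_trans IH; rewrite exprSr -mulrA ler_wpM2l ?exprn_ge0 ?subr_ge0 //.
rewrite -natr1; have : 0 <= b%:R :> R by [].
move: (b%:R) => x x0; nra.
Qed.

Lemma nat_root n k : exists b : nat, (b ^ k.+1 <= n < b.+1 ^ k.+1)%N.
Proof.
have ex0 : exists b : nat, (b ^ k.+1 <= n)%N by exists 0%N; rewrite exp0n.
have bound b : (b ^ k.+1 <= n)%N -> (b <= n)%N.
  by apply: leq_trans; rewrite -{1}[b]expn1; case: b => // b; rewrite leq_pexp2l.
have [b bn bmax] := ex_maxnP ex0 bound; exists b; rewrite bn /= ltnNge.
by apply/negP => /bmax; rewrite ltnn.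
Qed.

Lemma has_block_clique n (G : graph n) k k' B : (B * k <= n)%N ->
  has (fun i => clique G (vertices n (block k i))) (iota 0 B) ->
  has (fun s => size s == k) (cliques (adj_nat G k') (B * k)).
Proof.
move=> Bkn /hasP[i]; rewrite mem_iota add0n => /andP[_ iB] cl.
apply/hasP; exists (block k i); last by rewrite size_rev size_iota.
by rewrite mem_cliques // cl andbT block_declists // leq_mul2r iB orbT.
Qed.

(* The first rbk vertices, where b is the (k+1)-st root of n rounded down, contain
   rb disjoint blocks. For fixed k, a clique among them is found in time O(n), and
   none of them is a clique with probability O(n^-k). *)
Lemma dense_avgFPT (R : realType) (p : nat -> R) :
  (forall n, 0 <= p n <= 1) -> subpoly_dense p -> avgFPT_time p clique_program.
Proof.
(* With q = p^C(k,2), the power [m] is chosen such that (qb)^m is at least a constant times n; its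
   [k]-th power then outweighs n^k, whence [r]. *)
move=> p01 dp; apply: (@avgFPT_clique_program _ _ 1) => // k.
pose m := (k.+1 * 2)%N; pose r := (m * k)%N.
have [n0 n0P] := dp ('C(k, 2) * m)%N.
(* The first summand stems from the search in the blocks, the second from the exhaustive search
   weighted by the probability that no block is a clique. *)
exists ((54 * (r * k).+1 ^ k.+1)%:R + (108 * 2 ^ k.+1)%:R * 4%:R ^+ (k.+1 * k)).
(* Such [n] force rk < b, so for k > 0 the blocks fit: brk <= b^2 <= b^(k+1) <= n. *)
exists (maxn n0 ((r * k).+1 ^ k.+1)) => n.
rewrite geq_max => /andP[n0n rkn] n1.
have [b /andP[bn nb]] := nat_root n k.
have rkb : (r * k < b)%N by rewrite -ltnS -(@ltn_exp2r _ _ k.+1) // (leq_ltn_trans rkn).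
have b0 : (0 < b)%N by apply: leq_ltn_trans rkb.
have Mn : (b * r * k <= n)%N.
  case: (posnP k) => [->|k0]; first by rewrite muln0.
  apply: leq_trans bn; apply: (@leq_trans (b ^ 2)).
    by rewrite -mulnA -mulnn leq_mul2l ltnW ?orbT.
  by rewrite leq_pexp2l.
pose bl (G : graph n) :=
  has (fun i => clique G (vertices n (block k i))) (iota 0 (b * r)).
pose TM : nat := 54 * (b * r * k).+1 ^ k.+1.
pose Tn : nat := 108 * n.+1 ^ k.+1.
exists (fun G => TM%:R + (~~ bl G)%:R * Tn%:R); split=> [G|].
  have [hb|nhb] := boolP (bl G).
    have hM := has_block_clique k Mn hb.
    have acc := @halts_accepting (encode G k) n k erefl erefl _ Mn hM.
    apply: le_trans (@running_time_le R _ _ _ (fun s => (0 < regs s 0)%N) acc) _.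
    by rewrite mul0r addr0 lee_fin ler_nat cost_exp.
  apply: (le_trans (running_time_le R (@halts (encode G k) n k erefl erefl))).
  rewrite lee_fin mul1r -natrD ler_nat; apply: leq_trans (leq_addl _ _).
  by rewrite /Tn -[108%N]/(2 * 54)%N -mulnA leq_mul2l /= cost_exp.
pose q := p n ^+ 'C(k, 2).
have /andP[p0 p1] := p01 n.
have q01 : 0 <= q <= 1 by rewrite exprn_ge0 // exprn_ile1.
have -> : \sum_(G : graph n) gnp (p n) G * (TM%:R + (~~ bl G)%:R * Tn%:R) =
          TM%:R + (1 - q) ^+ (b * r) * Tn%:R.
  rewrite -(no_block_clique _ Mn) mulr_suml -[X in X + _]mul1r.
  rewrite -(gnp_total n (p n)) mulr_suml -big_split /=.
  by apply: eq_bigr => G _; rewrite mulrDr mulrA.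
rewrite expr1 mulrDl; apply: lerD.
  rewrite -natrM ler_nat /TM -[leqRHS]mulnA leq_mul2l /=.
  apply: (@leq_trans (((r * k).+1 * b) ^ k.+1)); first by rewrite leq_exp2r //; lia.
  by rewrite expnMn leq_mul2l bn orbT.
(* Density gives q^m >= 1/n, and b^m is the square of b^(k+1) >= n/2^(k+1), because n < (b+1)^(k+1)
   <= (2b)^(k+1). *)
have nm : n%:R <= (q * b%:R) ^+ m * 4%:R ^+ k.+1.
  have : n%:R <= b%:R ^+ k.+1 * 2%:R ^+ k.+1 :> R.
    rewrite -!natrX -natrM ler_nat -expnMn; apply: leq_trans (ltnW nb) _.
    by rewrite leq_exp2r //; lia.
  have := n0P n n0n n1; rewrite exprM -/q exprMn.
  have -> : b%:R ^+ m = (b%:R ^+ k.+1) ^+ 2 :> R by rewrite -exprM.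
  have -> : 4%:R ^+ k.+1 = (2%:R ^+ k.+1) ^+ 2 :> R.
    by rewrite -exprM mulnC exprM; congr (_ ^+ _); ring.
  have : 1 <= n%:R :> R by rewrite ler1n.
  have : 0 <= q ^+ m by rewrite exprn_ge0 //; case/andP: q01.
  move: (q ^+ m) (n%:R : R) (b%:R ^+ k.+1) (2%:R ^+ k.+1) => x N y z x0 N1 xN Nyz.
  have : N ^+ 2 <= (y * z) ^+ 2 by rewrite ler_sqr ?nnegrE //; lra.
  have : N <= x * N ^+ 2 by rewrite expr2 mulrA ler_peMl //; lra.
  move=> h1 h2; apply: (le_trans h1); rewrite -mulrA -exprMn ler_wpM2l //.
(* By [nm], n^k is at most a constant times (qb)^(mk), and the power r = mk of [expr_1B_le] absorbs
   it. *)
have small : (1 - q) ^+ (b * r) * n%:R ^+ k <= 4%:R ^+ (k.+1 * k).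
  apply: (@le_trans _ _ ((1 - q) ^+ (b * r) * ((q * b%:R) ^+ m * 4%:R ^+ k.+1) ^+ k)).
    apply: ler_wpM2l; first by rewrite exprn_ge0 // subr_ge0; case/andP: q01.
    by rewrite lerXn2r ?nnegrE // (le_trans _ nm).
  rewrite exprMn -!exprM mulrA exprM -exprMn -[leRHS]mul1r.
  apply: ler_wpM2r; first by rewrite exprn_ge0.
  rewrite exprn_ile1 ?expr_1B_le // mulr_ge0 ?exprn_ge0 ?subr_ge0 //;
    by case/andP: q01 => // *; rewrite mulr_ge0.
apply: (@le_trans _ _ ((108 * 2 ^ k.+1)%:R * ((1 - q) ^+ (b * r) * n%:R ^+ k) * n%:R)).
  rewrite mulrCA -!mulrA.
  apply: ler_wpM2l; first by rewrite exprn_ge0 // subr_ge0; case/andP: q01.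
  rewrite -exprSr -natrX -natrM ler_nat /Tn -mulnA leq_mul2l /= -expnMn.
  by rewrite leq_exp2r //; lia.
by rewrite ler_wpM2r // ler_wpM2l.
Qed.

Theorem theorem1 (R : realType) (p : nat -> R)
  (p01 : forall n : nat, 0 <= p n <= 1)
  (p_natural : natural_function p) :
  exists A : program, decides_clique A /\ avgFPT_time p A.
Proof.
exists clique_program; split; first exact: clique_program_decides.
case: (natural_sparse_or_dense p_natural) => [sp|dp].
  exact: sparse_avgFPT.
exact: dense_avgFPT.
Qed.
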